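(* Let $n_1 \ge 0$ and $n_2 > 0$ be integers and let $d_1, d_2$ be distinct non-negative real numbers such that $n_1 d_1 \le n_2 d_2$. Then $$\rho(\mathcal{M}_{d_1,n_1,d_2,n_2}) = \frac{1}{2}\left[d_2 - d_1 \frac{n_1}{n_2} + \sqrt{4d_1^2 \frac{n_1}{n_2} + \left(d_2 - d_1 \frac{n_1}{n_2}\right)^2}\,\right].$$ Moreover, a matrix $M \in \mathcal{M}_{d_1,n_1,d_2,n_2}$ satisfies $\rho(M) = \rho(\mathcal{M}_{d_1,n_1,d_2,n_2})$ if and only if the induced graph of $M$ on its degree-$d_1$ vertices is empty and the induced graph of $M$ on its degree-$d_2$ vertices is regular.
   Context: For a square matrix $M$, $\rho(M)$ denotes its spectral radius. A weighted graph on $n$ vertices is a symmetric $n\times n$ real matrix $M$ with non-negative entries (diagonal entries, i.e. self-loops, are allowed to be non-zero); vertices are row indices, and the degree of vertex $i$ is the row sum $\sum_j M_{ij}$. $\mathcal{M}_{d_1,n_1,d_2,n_2}$ is the set of all such matrices with $n = n_1+n_2$ having $n_1$ rows of sum $d_1$ and $n_2$ rows of sum $d_2$. For a set $\mathcal{M}$ of such matrices, $\rho(\mathcal{M}) = \min\{\rho(M) : M \in \mathcal{M}\}$ (the minimum is attained for $\mathcal{M}_{d_1,n_1,d_2,n_2}$ by compactness). For a set $U$ of vertices, the induced graph $M_{|U}$ is the principal submatrix of $M$ on the rows and columns in $U$; it is empty if all its entries (including diagonal ones) are zero, and regular if all its row sums are equal. *)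

(* Defs.v *)
From HB Require Import structures.
From mathcomp Require Import all_boot all_order all_algebra.
From mathcomp Require Import all_classical all_reals.
From mathcomp Require Import complex.

Set Implicit Arguments.
Unset Strict Implicit.
Unset Printing Implicit Defensive.

Import Order.TTheory GRing.Theory Num.Theory.

Local Open Scope classical_set_scope.
Local Open Scope ring_scope.

(* Supremum of the moduli of the complex eigenvalues of [M]. There are finitely
   many of them, so for [0 < n] the supremum is a maximum. The norm on [R[i]]
   takes values in [R[i]], whence the real part. *)
Definition spectral_radius (R : realType) (n : nat) (M : 'M[R]_n) : R :=
  sup [set complex.Re `|l| |
         l in [set l : R[i] | eigenvalue (map_mx (real_complex R) M) l]].

Definition weighted_graph (R : realType) (n : nat) (M : 'M[R]_n) : Prop :=
  M^T = M /\ forall i j, 0 <= M i j.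

Definition degree (R : realType) (n : nat) (M : 'M[R]_n) (i : 'I_n) : R :=
  \sum_j M i j.

Definition degree_class (R : realType) (n : nat) (M : 'M[R]_n) (d : R) :
  {set 'I_n} := [set i | degree M i == d]%SET.

(* For [d1 = d2] this is not the class of graphs with all degrees [d1]; it is
   only meant for [d1 != d2]. *)
Definition two_degree_graphs (R : realType) (d1 : R) (n1 : nat) (d2 : R)
    (n2 : nat) : set 'M[R]_(n1 + n2) :=
  [set M | [/\ weighted_graph M, #|degree_class M d1| = n1
             & #|degree_class M d2| = n2]].
Arguments two_degree_graphs {R} d1 n1 d2 n2.

Definition induced (R : realType) (n : nat) (M : 'M[R]_n) (U : {set 'I_n}) :
    'M[R]_#|U| :=
  mxsub enum_val enum_val M.

Definition empty_graph (R : realType) (n : nat) (M : 'M[R]_n) : Prop :=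
  forall i j, M i j = 0.

Definition regular_graph (R : realType) (n : nat) (M : 'M[R]_n) : Prop :=
  forall i j, degree M i = degree M j.

(* This is the minimum of the spectral radii over [S] when it is attained. *)
Definition min_spectral_radius (R : realType) (n : nat) (S : set 'M[R]_n) : R :=
  inf [set spectral_radius M | M in S].

Definition min_spectral_radius_attained (R : realType) (n : nat)
    (S : set 'M[R]_n) : Prop :=
  exists2 M, S M & forall N, S N -> spectral_radius M <= spectral_radius N.

(* Main.v *)
Require Import Defs.
From mathcomp Require Import all_boot all_order all_algebra.
From mathcomp Require Import all_classical all_reals.
From mathcomp Require Import complex spectral sesquilinear ring lra.

Import Order.TTheory GRing.Theory Num.Theory.
Local Open Scope ring_scope.

(** Write U for the set of vertices of degree d1. If U is empty of edges and
    its complement is regular, then the partition into U and its complement is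
    equitable, with quotient matrix
      [ 0             d1             ]
      [ d1 (n1/n2)    d2 - d1 (n1/n2) ],
    and the claimed value lam is the largest eigenvalue of this matrix. Let
    (a, 1) be an eigenvector of it for lam, so that a lam = d1 (if lam = 0, then
    n1 d1 = d2 = 0, and a = 0 serves instead), and let x be the vector equal to
    a on U and to 1 off U.

    Lower bound. The degrees determine the quadratic form of any M at x up to
    the total weight e of M inside U: moving weight out of U keeps the row
    sums, and [two_value_form] gives
      x M x^T = lam (x x^T) + (a - 1)^2 e >= lam (x x^T).
    As M is symmetric, the left-hand side is at most rho(M) (x x^T)
    ([rayleigh_leif]), so lam <= rho(M).

    Equality. Since d1 <> d2, (1, 1) is not an eigenvector of the quotient
    matrix, that is, a <> 1. Hence rho(M) = lam forces e = 0, so that U is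
    empty, and makes x an eigenvector of M; reading the eigenvector equation at
    a vertex off U, where the degree is d2, yields the weight which that vertex
    sends into U, and this is the same at all these vertices
    ([spectral_radius_ge_quotient]).

    Conversely, if U is empty and its complement regular, then M w <= lam w
    for the positive vector w = x, and a positive supersolution bounds the
    modulus of every eigenvalue ([spectral_radius_le_weight]). The entry a may
    vanish in degenerate cases, which [quotient_supersolution] repairs
    ([spectral_radius_le_quotient]).

    The minimum is attained by the graph whose entries are constant on the
    blocks of the partition ([quotient_graph_extremal]). *)

(** * Spectral radius and Rayleigh quotients *)

(** A positive supersolution w of |M| w <= lam w bounds the eigenvalues: pairing
    the moduli of a left eigenvector v with w gives
    |l| (|v| . w) <= |v| |M| w <= lam (|v| . w), and |v| . w is positive. *)
Lemma eigenvalue_norm_le_weight {R : realType} {n : nat} {M : 'M[R]_n}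
    {w : 'I_n -> R} {lam : R} (w_gt0 : forall i, 0 < w i)
    (wM : forall i, \sum_j `|M i j| * w j <= lam * w i)
    (l : R[i]) (Ml : eigenvalue (map_mx (real_complex R) M) l) :
  complex.Re `|l| <= lam.
Proof.
have [v vM v_neq0] := eigenvalueP Ml.
pose S := \sum_j `|v 0 j| * (real_complex R) (w j).
have term_ge0 j : 0 <= `|v 0 j| * (real_complex R) (w j).
  by rewrite mulr_ge0 // ler0c ltW.
have S_gt0 : 0 < S.
  rewrite lt0r sumr_ge0 ?andbT //.
  apply: contra v_neq0 => /eqP/(psumr_eq0P (fun j _ => term_ge0 j)) S0.
  apply/eqP/rowP => j; rewrite mxE; have /eqP := S0 j isT.
  have wj_gt0 : 0 < real_complex R (w j) by rewrite ltcR.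
  by rewrite mulf_eq0 (gt_eqF wj_gt0) orbF normr_eq0 => /eqP.
rewrite -lecR RRe_real ?normr_real // -(ler_pM2r S_gt0).
have -> : `|l| * S = \sum_j `|l * v 0 j| * (real_complex R) (w j).
  by rewrite mulr_sumr; apply: eq_bigr => j _; rewrite normrM mulrA.
apply: (@le_trans _ _ (\sum_j (\sum_i `|v 0 i| * (real_complex R) `|M i j|)
                         * (real_complex R) (w j))).
  apply: ler_sum => j _; apply: ler_wpM2r; first by rewrite ler0c ltW.
  have /rowP/(_ j) := vM; rewrite !mxE => <-.
  apply: le_trans (ler_norm_sum _ _ _) _; apply: ler_sum => i _.
  rewrite normrM mxE ler_wpM2l //.
  by rewrite normc_def /= expr0n addr0 sqrtr_sqr.
under eq_bigr do rewrite mulr_suml.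
rewrite exchange_big mulr_sumr; apply: ler_sum => i _ /=.
under eq_bigr do rewrite -mulrA -rmorphM.
rewrite -mulr_sumr -rmorph_sum mulrCA ler_wpM2l // -rmorphM lecR.
exact: wM.
Qed.

(** A supremum of reals dominates its set only if the set is bounded; the
    weights w = 1 give a bound. *)
Lemma eigenvalue_le_spectral_radius {R : realType} {n : nat} (M : 'M[R]_n)
    (l : R[i]) (Ml : eigenvalue (map_mx (real_complex R) M) l) :
  complex.Re `|l| <= spectral_radius M.
Proof.
apply: ub_le_sup; last by exists l.
exists (\sum_i \sum_j `|M i j|) => _ [k Mk <-].
apply: (eigenvalue_norm_le_weight (w := fun=> 1)) Mk => // i.
rewrite mulr1; under eq_bigr do rewrite mulr1.
rewrite [leRHS](bigD1 i) //= lerDl; apply: sumr_ge0 => k' _.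
exact: sumr_ge0.
Qed.

Lemma spectral_radius_le_weight {R : realType} {n : nat} {M : 'M[R]_n}
    {w : 'I_n -> R} {lam : R} (lam_ge0 : 0 <= lam) (w_gt0 : forall i, 0 < w i)
    (wM : forall i, \sum_j `|M i j| * w j <= lam * w i) :
  spectral_radius M <= lam.
Proof.
(* Without eigenvalues the supremum is 0, hence the assumption on lam. *)
rewrite /spectral_radius; set E := (X in sup X).
have [->|/set0P E_neq0] := eqVneq E classical_sets.set0; first by rewrite sup0.
by apply: ge_sup => // _ [l Ml <-]; exact: eigenvalue_norm_le_weight wM _ Ml.
Qed.

(** In a unitary eigenbasis of the complexified matrix, with real eigenvalues
    D_k and with coordinates y_k of x, the gap between the two sides is the sum
    of the non-negative terms (rho - D_k) |y_k|^2. It vanishes only if D_k = rho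
    wherever y_k is non-zero, that is, if x is an eigenvector for rho. *)
Lemma rayleigh_leif {R : realType} {n : nat} (M : 'M[R]_n) (x : 'rV[R]_n)
    (Msym : M^T = M) (rho := spectral_radius M) :
  (x *m M *m x^T) 0 0 <= rho * (x *m x^T) 0 0
    ?= iff (x *m M == rho *: x).
Proof.
pose toC := real_complex R; pose A := map_mx toC M.
have toCM : {morph toC : a b / a * b} by exact: rmorphM.
have Aherm : A \is hermsymmx.
  apply/is_hermitianmxP; rewrite expr0 scale1r; apply/matrixP => i j.
  by rewrite !mxE -{1}Msym mxE; exact/esym/conjc_real.
have /orthomx_spectralP AE := hermitian_normalmx Aherm.
have D_real := hermitian_spectral_diag_real Aherm.
set P := spectralmx A in AE *; set D := spectral_diag A in AE D_real.
have P_unit : P \in unitmx := spectral_unit A.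
have PE := invmx_unitary (spectral_unitarymx A).
pose z := map_mx toC x; pose y := z *m invmx P.
have zE : z = y *m P by rewrite mulmxKV.
have zT : z^T = invmx P *m (y ^t Num.conj)%sesqui.
  rewrite PE -map_mxM -trmx_mul -zE; apply/matrixP => i j.
  by rewrite !mxE; exact/esym/conjc_real.
have zMz : toC ((x *m M *m x^T) 0 0) = \sum_k D 0 k * `|y 0 k| ^+ 2.
  have -> : toC ((x *m M *m x^T) 0 0) = (z *m A *m z^T) 0 0.
    by rewrite /z map_trmx -!map_mxM [RHS]mxE.
  rewrite AE zT !mulmxA -/y mulmxK // mul_mx_diag mxE.
  by apply: eq_bigr => k _; rewrite !mxE normCK mulrAC mulrC mulrA.
have zz : toC ((x *m x^T) 0 0) = \sum_k `|y 0 k| ^+ 2.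
  have -> : toC ((x *m x^T) 0 0) = (z *m z^T) 0 0.
    by rewrite /z map_trmx -!map_mxM [RHS]mxE.
  by rewrite zT mulmxA -/y mxE; apply: eq_bigr => k _; rewrite !mxE normCK.
have PA : P *m A = diag_mx D *m P.
  by rewrite [A]AE -mulmxA mulKVmx.
have D_le k : D 0 k <= toC rho.
  have Dk_real : D 0 k \is Num.real by exact: (mxOverP D_real).
  rewrite (le_trans (real_ler_norm Dk_real)) //.
  rewrite -[`|_|]RRe_real ?normr_real // lecR.
  apply: eigenvalue_le_spectral_radius; apply/eigenvalueP.
  exists (row k P).
    by rewrite -row_mul PA mul_diag_mx; apply/rowP => j; rewrite !mxE.
  apply/eqP; rewrite rowE => /(congr1 (mulmx^~ (invmx P))).
  rewrite mulmxK // mul0mx => /rowP/(_ k)/eqP.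
  by rewrite !mxE !eqxx oner_eq0.
have term_le k : D 0 k * `|y 0 k| ^+ 2 <= toC rho * `|y 0 k| ^+ 2.
  by rewrite ler_wpM2r ?exprn_ge0.
split.
  by rewrite -lecR -/toC zMz toCM zz mulr_sumr; exact: ler_sum.
apply/eqP/eqP => [eq_x|->]; last by rewrite -scalemxAl mxE.
pose gap k := toC rho * `|y 0 k| ^+ 2 - D 0 k * `|y 0 k| ^+ 2.
have gap_ge0 k : true -> 0 <= gap k by rewrite subr_ge0.
have gap_sum0 : \sum_k gap k = 0.
  by rewrite sumrB -mulr_sumr -zz -zMz eq_x toCM subrr.
have yD k : D 0 k * y 0 k = toC rho * y 0 k.
  have /eqP : gap k = 0 by exact: (psumr_eq0P gap_ge0 gap_sum0).
  rewrite /gap -mulrBl mulf_eq0 subr_eq0 sqrf_eq0 normr_eq0.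
  by move=> /orP [/eqP ->|/eqP ->] //; rewrite !mulr0.
have xM : map_mx toC (x *m M) = map_mx toC (rho *: x).
  rewrite map_mxM map_mxZ -/z -/A [A]AE !mulmxA -/y zE scalemxAl.
  congr (_ *m P); rewrite mul_mx_diag; apply/rowP => k.
  by rewrite [LHS]mxE [RHS]mxE mulrC; exact: yD.
apply/rowP => j; apply: complexI.
by have /rowP/(_ j) := xM; rewrite [LHS]mxE [RHS]mxE.
Qed.

(** * The quotient matrix *)

(** The largest eigenvalue of the quotient matrix of an equitable partition
    into p vertices of degree d1 without inner edges and q vertices of degree
    d2. The sizes are real numbers, as only ratios and products with degrees
    occur. *)
Definition quotient_radius {R : realType} (p q d1 d2 : R) : R :=
  2^-1 * (d2 - d1 * (p / q) +
          Num.sqrt (4 * d1 ^+ 2 * (p / q) + (d2 - d1 * (p / q)) ^+ 2)).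

(** The characteristic equation of the quotient matrix, multiplied by q. *)
Lemma quotient_radius_root {R : realType} {p q : R} (d1 d2 : R)
    (p_ge0 : 0 <= p) (q_gt0 : 0 < q) (lam := quotient_radius p q d1 d2) :
  q * lam ^+ 2 = (q * d2 - p * d1) * lam + p * d1 ^+ 2.
Proof.
pose t := d2 - d1 * (p / q).
pose s := Num.sqrt (4 * d1 ^+ 2 * (p / q) + t ^+ 2).
have lamE : lam = (t + s) / 2 by rewrite mulrC.
have sE : s ^+ 2 = 4 * d1 ^+ 2 * (p / q) + t ^+ 2.
  rewrite sqr_sqrtr // addr_ge0 ?sqr_ge0 //.
  by apply: mulr_ge0; [rewrite mulr_ge0 ?sqr_ge0|rewrite divr_ge0 // ltW].
have qt : q * d2 - p * d1 = q * t by rewrite /t; field; exact: lt0r_neq0.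
have -> : q * lam ^+ 2 = q / 4 * (t ^+ 2 + 2 * t * s + s ^+ 2).
  by rewrite lamE; field.
by rewrite sE qt lamE; field; exact: lt0r_neq0.
Qed.

Lemma quotient_radius_ge0 {R : realType} {p q d1 d2 : R}
    (q_gt0 : 0 < q) (le_pd1_qd2 : p * d1 <= q * d2) :
  0 <= quotient_radius p q d1 d2.
Proof.
rewrite mulr_ge0 ?invr_ge0 // addr_ge0 ?sqrtr_ge0 // subr_ge0 mulrA.
by rewrite ler_pdivrMr // mulrC [leRHS]mulrC.
Qed.

Lemma quotient_radius_eq0 {R : realType} {p q d1 d2 : R} (p_ge0 : 0 <= p)
    (q_gt0 : 0 < q) (le_pd1_qd2 : p * d1 <= q * d2) :
  quotient_radius p q d1 d2 = 0 -> p * d1 = 0 /\ d2 = 0.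
Proof.
move=> lam0; have := quotient_radius_root d1 d2 p_ge0 q_gt0.
rewrite /= lam0 expr0n !mulr0 add0r => /esym/eqP.
rewrite mulf_eq0 sqrf_eq0 -mulf_eq0 => /eqP pd1; split=> //.
move/eqP: lam0; rewrite mulf_eq0 invr_eq0 pnatr_eq0 /=.
have -> : d1 * (p / q) = 0 by rewrite mulrA (mulrC d1) pd1 mul0r.
rewrite subr0 paddr_eq0 ?sqrtr_ge0 // => [/andP [/eqP]//|].
by move: le_pd1_qd2; rewrite pd1 pmulr_rge0.
Qed.

(** (a, 1) is an eigenvector of the quotient matrix. The first equation carries
    a factor p: for p = 0 the first row is absent, and a lam = d1 has no
    solution when lam = 0 < d1. If lam <> 0 then a = d1 / lam, and a = 1 would
    turn the characteristic equation into d1 = d2. *)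
Lemma quotient_eigenvector {R : realType} {p q d1 d2 : R} (p_ge0 : 0 <= p)
    (q_gt0 : 0 < q) (d1_neq_d2 : d1 <> d2) (le_pd1_qd2 : p * d1 <= q * d2)
    (lam := quotient_radius p q d1 d2) :
  exists a, [/\ a != 1, p * (a * lam) = p * d1
               & q * lam = q * d2 - p * d1 + p * d1 * a].
Proof.
have /= root := quotient_radius_root d1 d2 p_ge0 q_gt0; rewrite -/lam in root.
have [lam0|lam_neq0] := eqVneq lam 0.
  have [pd1 d2_0] := quotient_radius_eq0 p_ge0 q_gt0 le_pd1_qd2 lam0.
  exists 0; split; first by rewrite eq_sym oner_eq0.
    by rewrite mul0r mulr0 pd1.
  by rewrite lam0 d2_0 pd1 !mulr0 subr0 addr0.
exists (d1 / lam); split.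
- apply/eqP => /(congr1 ( *%R^~ lam)); rewrite divfK // mul1r => d1E.
  have : q * lam * (d1 - d2) = 0 by move: root; rewrite -d1E; lra.
  have qlam_neq0 : q * lam != 0 by rewrite mulf_neq0 // gt_eqF.
  by move/eqP; rewrite mulf_eq0 (negbTE qlam_neq0) subr_eq0 => /eqP.
- by rewrite divfK.
- apply: (mulIf lam_neq0).
  transitivity (q * lam ^+ 2); first by rewrite expr2 mulrA.
  by rewrite root; field.
Qed.

(** The eigenvector (a, 1) serves when a > 0. Otherwise p d1 = 0: the classes
    do not interact, and b = 1 works. *)
Lemma quotient_supersolution {R : realType} {p q d1 d2 : R} (p_ge0 : 0 <= p)
    (q_gt0 : 0 < q) (d1_ge0 : 0 <= d1)
    (d1_neq_d2 : d1 <> d2) (le_pd1_qd2 : p * d1 <= q * d2)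
    (lam := quotient_radius p q d1 d2) :
  exists b, [/\ 0 < b, p * d1 <= p * (lam * b)
               & q * d2 - p * d1 + p * d1 * b <= q * lam].
Proof.
have lam_ge0 : 0 <= lam := quotient_radius_ge0 q_gt0 le_pd1_qd2.
have [a [_ eig1 eig2]] := quotient_eigenvector p_ge0 q_gt0 d1_neq_d2 le_pd1_qd2.
rewrite -/lam in eig1 eig2.
have [a_gt0|a_le0] := ltP 0 a.
  by exists a; rewrite eig2 [lam * a]mulrC eig1.
have pd1 : p * d1 = 0.
  apply/le_anti; rewrite mulr_ge0 // -eig1 andbT.
  by rewrite mulr_ge0_le0 // mulr_le0_ge0.
exists 1; rewrite eig2 pd1 !mul0r; split=> //.
by rewrite mulr1 mulr_ge0.
Qed.

(** * Degrees into a vertex set *)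

Definition degree_in {R : realType} {n : nat} (M : 'M[R]_n) (U : {set 'I_n})
  (i : 'I_n) : R := \sum_(j in U) M i j.

Lemma sum_setC {R : realType} {n : nat} (U : {set 'I_n}) (F : 'I_n -> R) :
  \sum_i F i = \sum_(i in U) F i + \sum_(i in ~: U) F i.
Proof.
rewrite (bigID (mem U)) /=; congr (_ + _).
by apply: eq_bigl => j; rewrite finset.in_setC.
Qed.

Lemma degree_split {R : realType} {n : nat} (M : 'M[R]_n) (U : {set 'I_n}) i :
  degree M i = degree_in M U i + degree_in M (~: U) i.
Proof. exact: sum_setC. Qed.

Lemma degree_in_ge0 {R : realType} {n : nat} {M : 'M[R]_n} {U : {set 'I_n}} i
  (Mw : weighted_graph M) : 0 <= degree_in M U i.
Proof. by apply: sumr_ge0 => j _; exact: Mw.2. Qed.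

Lemma sum_degree_in {R : realType} {n : nat} {M : 'M[R]_n} {U : {set 'I_n}}
  (Msym : M^T = M) : \sum_i degree_in M U i = \sum_(i in U) degree M i.
Proof.
rewrite /degree_in exchange_big; apply: eq_bigr => j _; apply: eq_bigr => i _.
by rewrite -{1}Msym mxE.
Qed.

Lemma empty_inducedP {R : realType} {n : nat} (M : 'M[R]_n) (U : {set 'I_n}) :
  weighted_graph M ->
  empty_graph (induced M U) <-> \sum_(i in U) degree_in M U i = 0.
Proof.
move=> Mw; split=> [U0|U0 i j].
  apply: big1 => i Ui; apply: big1 => j Uj.
  by have := U0 (enum_rank_in Ui i) (enum_rank_in Ui j);
    rewrite mxE !enum_rankK_in.
rewrite mxE.
have : degree_in M U (enum_val i) = 0.
  apply: (psumr_eq0P _ U0 (enum_valP i)) => k _; exact: degree_in_ge0.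
by move=> /psumr_eq0P -> //; [move=> k _; exact: Mw.2|exact: enum_valP].
Qed.

Lemma degree_induced {R : realType} {n : nat} (M : 'M[R]_n) (U : {set 'I_n}) i :
  degree (induced M U) i = degree_in M U (enum_val i).
Proof.
by rewrite /degree_in big_enum_val; apply: eq_bigr => j _; rewrite mxE.
Qed.

Lemma regular_inducedP {R : realType} {n : nat} (M : 'M[R]_n) (U : {set 'I_n}) :
  regular_graph (induced M U) <-> {in U &, forall i j,
    degree_in M U i = degree_in M U j}.
Proof.
split=> [reg i j Ui Uj|reg i j]; last first.
  by rewrite !degree_induced; apply: reg; exact: enum_valP.
have := reg (enum_rank_in Ui i) (enum_rank_in Ui j).
by rewrite !degree_induced !enum_rankK_in.
Qed.

(** * Graphs with two degrees *)

(** The lift to all vertices of the vector (a, 1) on the two classes. *)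
Definition two_value {R : realType} {n : nat} (U : {set 'I_n}) (a : R)
    (i : 'I_n) : R :=
  if i \in U then a else 1.

(** The vector is the constant 1 plus a - 1 times the indicator of U. *)
Lemma sum_two_value {R : realType} {n : nat} (M : 'M[R]_n) (U : {set 'I_n})
    (a : R) i :
  \sum_j M i j * two_value U a j = degree M i + (a - 1) * degree_in M U i.
Proof.
rewrite (degree_split M U) (bigID (mem U)) /= addrAC; congr (_ + _).
  rewrite -{1}[degree_in _ _ _]mul1r -mulrDl [1 + _]addrC subrK mulr_sumr.
  by apply: eq_bigr => j Uj; rewrite /two_value Uj mulrC.
rewrite /degree_in; apply: eq_big => [j|j /negbTE Uj]; first by rewrite inE.
by rewrite /two_value Uj mulr1.
Qed.

(** The weight sent into U by all vertices is, by symmetry, the sum of the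
    degrees in U. *)
Lemma sum_degree_in_setC {R : realType} {n : nat} {M : 'M[R]_n}
    {U : {set 'I_n}} {d1 d2 : R} (Msym : M^T = M)
    (degM : forall i, degree M i = if i \in U then d1 else d2) :
  \sum_(i in ~: U) degree_in M U i =
    #|U|%:R * d1 - \sum_(i in U) degree_in M U i.
Proof.
apply/eqP; rewrite eq_sym subr_eq addrC -sum_setC sum_degree_in // mulr_natl.
by rewrite -sumr_const; apply/eqP/eq_bigr => i Ui; rewrite degM Ui.
Qed.

(** Only the total weight inside U is left undetermined by the degrees: the
    edges inside U, across, and outside U have weights e, #|U| d1 - e and
    #|~: U| d2 - #|U| d1 + e, and contribute with the factors a^2, 2 a and 1.
    Collecting e gives the square of a - 1. *)
Lemma two_value_form {R : realType} {n : nat} {M : 'M[R]_n}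
    {U : {set 'I_n}} {d1 d2 : R} (a : R) (Msym : M^T = M)
    (degM : forall i, degree M i = if i \in U then d1 else d2)
    (x := \row_i two_value U a i) :
  (x *m M *m x^T) 0 0 =
    #|U|%:R * d1 * (2 * a - 1) + #|~: U|%:R * d2 +
    (a - 1) ^+ 2 * \sum_(i in U) degree_in M U i.
Proof.
rewrite -mulmxA mxE.
transitivity
  (\sum_i two_value U a i * (degree M i + (a - 1) * degree_in M U i)).
  apply: eq_bigr => i _; rewrite !mxE; congr (_ * _).
  by rewrite -sum_two_value; apply: eq_bigr => j _; rewrite !mxE.
rewrite (sum_setC U).
have -> : \sum_(i in U)
      two_value U a i * (degree M i + (a - 1) * degree_in M U i) =
    #|U|%:R * (a * d1) + a * (a - 1) * \sum_(i in U) degree_in M U i.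
  rewrite mulr_natl -sumr_const mulr_sumr -big_split /=.
  by apply: eq_bigr => i Ui; rewrite degM /two_value Ui mulrDr mulrA.
have -> : \sum_(i in ~: U)
      two_value U a i * (degree M i + (a - 1) * degree_in M U i) =
    #|~: U|%:R * d2 + (a - 1) * \sum_(i in ~: U) degree_in M U i.
  rewrite mulr_natl -sumr_const mulr_sumr -big_split /=.
  apply: eq_bigr => i; rewrite finset.in_setC => /negbTE Ui.
  by rewrite degM /two_value Ui mul1r.
rewrite (sum_degree_in_setC Msym degM); ring.
Qed.

Lemma two_value_norm {R : realType} {n : nat} (U : {set 'I_n}) (a : R)
    (x := \row_i two_value U a i) :
  (x *m x^T) 0 0 = #|U|%:R * a ^+ 2 + #|~: U|%:R.
Proof.
rewrite mxE (sum_setC U); congr (_ + _).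
  rewrite mulr_natl -sumr_const; apply: eq_bigr => i Ui.
  by rewrite !mxE /two_value Ui.
rewrite -sumr_const; apply: eq_bigr => i.
by rewrite finset.in_setC => /negbTE Ui; rewrite !mxE /two_value Ui mulr1.
Qed.

(** The quotient eigenvector, spread over the two classes, has Rayleigh
    quotient at least lam, with excess proportional to the weight inside U.
    When rho(M) = lam, the excess vanishes and the test vector is an
    eigenvector. *)
Lemma spectral_radius_ge_quotient {R : realType} {n : nat} {M : 'M[R]_n}
    {U : {set 'I_n}} {d1 d2 : R} (Mw : weighted_graph M)
    (degM : forall i, degree M i = if i \in U then d1 else d2)
    (U_neqT : (0 < #|~: U|)%N) (d1_neq_d2 : d1 <> d2)
    (le_d1_d2 : #|U|%:R * d1 <= #|~: U|%:R * d2)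
    (lam := quotient_radius #|U|%:R #|~: U|%:R d1 d2) :
  lam <= spectral_radius M /\
  (spectral_radius M = lam ->
   empty_graph (induced M U) /\ regular_graph (induced M (~: U))).
Proof.
have [Msym M_ge0] := Mw.
have q_gt0 : 0 < #|~: U|%:R :> R by rewrite ltr0n.
have [a [a_neq1 eig1 eig2]] :=
  quotient_eigenvector (ler0n R #|U|) q_gt0 d1_neq_d2 le_d1_d2.
rewrite -/lam in eig1 eig2.
pose x := \row_i two_value U a i; pose e := \sum_(i in U) degree_in M U i.
have e_ge0 : 0 <= e by apply: sumr_ge0 => i _; exact: degree_in_ge0.
have xMx : (x *m M *m x^T) 0 0 = lam * (x *m x^T) 0 0 + (a - 1) ^+ 2 * e.
  rewrite (two_value_form a Msym degM) two_value_norm -/e; congr (_ + _).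
  have : #|U|%:R * (a * lam) * a = #|U|%:R * d1 * a by rewrite eig1.
  lra.
have xx_gt0 : 0 < (x *m x^T) 0 0.
  by rewrite two_value_norm ltr_wpDl // mulr_ge0 // sqr_ge0.
have [ray rayE] := rayleigh_leif M x Msym.
have gap_ge0 : 0 <= (a - 1) ^+ 2 * e by rewrite mulr_ge0 ?sqr_ge0.
split.
  rewrite -(ler_pM2r xx_gt0); apply: le_trans ray.
  by rewrite xMx lerDl.
move=> rhoE; rewrite rhoE in ray rayE.
have gap0 : (a - 1) ^+ 2 * e = 0.
  by apply/le_anti; rewrite gap_ge0 andbT; rewrite xMx gerDl in ray.
have /eqP xM : x *m M == lam *: x by rewrite -rayE xMx gap0 addr0.
split.
  apply/(empty_inducedP _ _ Mw)/eqP; move/eqP: gap0.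
  by rewrite mulf_eq0 sqrf_eq0 subr_eq0 (negbTE a_neq1).
apply/regular_inducedP.
(* The coordinate of x M = lam x at a vertex off U determines the weight that
   this vertex sends into U, because a - 1 is non-zero. *)
have outside i : i \in ~: U -> (a - 1) * degree_in M U i = lam - d2 /\
   degree_in M (~: U) i = d2 - degree_in M U i.
  rewrite finset.in_setC => /negbTE Ui.
  have degi : degree M i = d2 by rewrite degM Ui.
  split; last by rewrite -degi (degree_split M U) addrC addKr.
  have /rowP/(_ i) := xM; rewrite !mxE /two_value Ui mulr1 => <-.
  rewrite -degi; apply/eqP; rewrite eq_sym subr_eq addrC -sum_two_value.
  by apply/eqP/eq_bigr => j _; rewrite mxE mulrC -{1}Msym mxE.
move=> i j /outside [ei ->] /outside [ej ->]; congr (_ - _).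
by apply: (@mulfI _ (a - 1)); rewrite ?subr_eq0 // ei ej.
Qed.

(** When U is empty and its complement regular, the partition is equitable, so
    that a supersolution of the quotient system lifts to one of M. *)
Lemma spectral_radius_le_quotient {R : realType} {n : nat} {M : 'M[R]_n}
    {U : {set 'I_n}} {d1 d2 : R} (Mw : weighted_graph M)
    (degM : forall i, degree M i = if i \in U then d1 else d2)
    (U_neqT : (0 < #|~: U|)%N) (d1_ge0 : 0 <= d1) (d1_neq_d2 : d1 <> d2)
    (le_d1_d2 : #|U|%:R * d1 <= #|~: U|%:R * d2) :
  empty_graph (induced M U) -> regular_graph (induced M (~: U)) ->
  spectral_radius M <= quotient_radius #|U|%:R #|~: U|%:R d1 d2.
Proof.
have [Msym M_ge0] := Mw.
move=> /(empty_inducedP _ _ Mw) e0 /regular_inducedP reg.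
have q_gt0 : 0 < #|~: U|%:R :> R by rewrite ltr0n.
have [b [b_gt0 sup1 sup2]] :=
  quotient_supersolution (ler0n R #|U|) q_gt0 d1_ge0 d1_neq_d2 le_d1_d2.
apply: (spectral_radius_le_weight (w := two_value U b)) => [|i|i].
- exact: quotient_radius_ge0.
- by rewrite /two_value; case: ifP.
under eq_bigr do rewrite ger0_norm //.
rewrite sum_two_value degM /two_value; case: ifP => [Ui|/negbT Ui].
  have -> : degree_in M U i = 0.
    by apply: (psumr_eq0P _ e0 Ui) => k _; exact: degree_in_ge0.
  rewrite mulr0 addr0 -(ler_pM2l (x := #|U|%:R)) // ltr0n.
  by apply/card_gt0P; exists i.
(* The weight #|U| d1 leaving U is shared evenly by the vertices off U: they
   have the same degree, and by regularity the same degree outside U. *)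
have cut : #|~: U|%:R * degree_in M U i = #|U|%:R * d1.
  rewrite -[RHS]subr0 -e0 -(sum_degree_in_setC Msym degM).
  rewrite mulr_natl -sumr_const.
  have sU : i \in ~: U by rewrite finset.in_setC.
  apply: eq_bigr => j Uj; have := reg _ _ sU Uj.
  have := degree_split M U i; have := degree_split M U j.
  rewrite !degM (negbTE Ui).
  by rewrite finset.in_setC in Uj; rewrite (negbTE Uj); lra.
rewrite mulr1 -(ler_pM2l q_gt0) mulrDr mulrCA cut.
by apply: le_trans sup2; lra.
Qed.

(** The two classes are disjoint as d1 <> d2, and their sizes add up to the
    number of vertices. *)
Lemma degree_two_degree_graphs {R : realType} {n1 n2 : nat} {d1 d2 : R}
    {M : 'M[R]_(n1 + n2)} (d1_neq_d2 : d1 <> d2)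
    (MS : two_degree_graphs d1 n1 d2 n2 M) :
  degree_class M d2 = ~: degree_class M d1 /\
  forall i, degree M i = if i \in degree_class M d1 then d1 else d2.
Proof.
have [_ U1 U2] := MS.
have UE : degree_class M d2 = ~: degree_class M d1.
  apply/eqP; rewrite eqEcard; apply/andP; split.
    apply/fintype.subsetP => i; rewrite !inE => /eqP ->.
    by apply/eqP => /esym.
  by rewrite U2 cardsCs finset.setCK U1 card_ord addKn.
split=> // i; have := erefl (i \in degree_class M d2).
rewrite {2}UE !inE.
by case: (eqVneq (degree M i) d1) => // _ /eqP.
Qed.

Lemma spectral_radius_two_degree {R : realType} {n1 n2 : nat} {d1 d2 : R}
    {M : 'M[R]_(n1 + n2)} (n2_gt0 : (0 < n2)%N) (d1_ge0 : 0 <= d1)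
    (d1_neq_d2 : d1 <> d2) (le_n1d1_n2d2 : n1%:R * d1 <= n2%:R * d2)
    (lam := quotient_radius n1%:R n2%:R d1 d2)
    (MS : two_degree_graphs d1 n1 d2 n2 M) :
  lam <= spectral_radius M /\
  (spectral_radius M = lam <->
   empty_graph (induced M (degree_class M d1)) /\
   regular_graph (induced M (degree_class M d2))).
Proof.
have [UE degM] := degree_two_degree_graphs d1_neq_d2 MS.
have [Mw U1 U2] := MS; rewrite UE in U2 *.
have U_neqT : (0 < #|~: degree_class M d1|)%N by rewrite U2.
have := spectral_radius_ge_quotient Mw degM U_neqT d1_neq_d2.
have := spectral_radius_le_quotient Mw degM U_neqT d1_ge0 d1_neq_d2.
have p_eq : #|degree_class M d1|%:R = n1%:R :> R by rewrite U1.
have q_eq : #|~: degree_class M d1|%:R = n2%:R :> R by rewrite U2.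
rewrite p_eq q_eq -/lam => le_lam /(_ le_n1d1_n2d2) [ge_lam eq_lam].
split=> //; split=> // -[U_empty U_reg].
by apply/le_anti; rewrite ge_lam andbT; exact: le_lam.
Qed.

(** * A graph that attains the bound *)

(** The block-constant matrix whose quotient by the partition is the quotient
    matrix. *)
Definition quotient_graph {R : realType} (n1 n2 : nat) (d1 d2 : R) :
    'M[R]_(n1 + n2) :=
  block_mx 0 (const_mx (d1 / n2%:R)) (const_mx (d1 / n2%:R))
    (const_mx ((d2 - d1 * (n1%:R / n2%:R)) / n2%:R)).

Lemma degree_quotient_graph {R : realType} (n1 n2 : nat) (d1 d2 : R) i :
  (0 < n2)%N ->
  degree (quotient_graph n1 n2 d1 d2) i = if (i < n1)%N then d1 else d2.
Proof.
move=> n2_gt0; have n2_neq0 : n2%:R != 0 :> R by rewrite pnatr_eq0 -lt0n.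
rewrite /degree /quotient_graph big_split_ord /=.
case: (split_ordP i) => k -> /=.
  rewrite big1 => [|j _]; last by rewrite block_mxEul mxE.
  under eq_bigr do rewrite block_mxEur mxE.
  by rewrite sumr_const card_ord add0r -[_ *+ n2]mulr_natr divfK.
under eq_bigr do rewrite block_mxEdl mxE.
under [X in _ + X]eq_bigr do rewrite block_mxEdr mxE.
by rewrite !sumr_const !card_ord -[_ *+ n1]mulr_natr -[_ *+ n2]mulr_natr; field.
Qed.

(** The hypothesis n1 d1 <= n2 d2 is what makes the lower right block
    non-negative. *)
Lemma quotient_graph_two_degree {R : realType} {n1 n2 : nat} {d1 d2 : R}
    (n2_gt0 : (0 < n2)%N) (d1_ge0 : 0 <= d1) (d1_neq_d2 : d1 <> d2)
    (le_n1d1_n2d2 : n1%:R * d1 <= n2%:R * d2) :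
  two_degree_graphs d1 n1 d2 n2 (quotient_graph n1 n2 d1 d2).
Proof.
have q_gt0 : 0 < n2%:R :> R by rewrite ltr0n.
have cross_ge0 : 0 <= d1 / n2%:R by rewrite divr_ge0 // ltW.
have inner_ge0 : 0 <= (d2 - d1 * (n1%:R / n2%:R)) / n2%:R.
  rewrite divr_ge0 ?(ltW q_gt0) // subr_ge0 mulrA ler_pdivrMr //.
  by rewrite mulrC [leRHS]mulrC.
have card_class d : #|degree_class (quotient_graph n1 n2 d1 d2) d| =
    ((d1 == d) * n1 + (d2 == d) * n2)%N.
  rewrite -sum1_card big_mkcond big_split_ord /=; congr (_ + _)%N.
    under eq_bigr do rewrite inE degree_quotient_graph //= ltn_ord.
    by rewrite sum_nat_const card_ord mulnC; case: (_ == d).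
  under eq_bigr do rewrite inE degree_quotient_graph //= ltnNge leq_addr.
  by rewrite sum_nat_const card_ord mulnC; case: (_ == d).
have /eqP/negbTE d12 := d1_neq_d2.
split.
- split; first by rewrite tr_block_mx !trmx_const.
  rewrite /quotient_graph => i j.
  case: (split_ordP i) => i' ->; case: (split_ordP j) => j' ->.
  + by rewrite block_mxEul mxE.
  + by rewrite block_mxEur mxE.
  + by rewrite block_mxEdl mxE.
  + by rewrite block_mxEdr mxE.
- by rewrite card_class eqxx eq_sym d12 mul1n addn0.
- by rewrite card_class eqxx d12 mul1n.
Qed.

Lemma quotient_graph_extremal {R : realType} {n1 n2 : nat} {d1 d2 : R}
    (n2_gt0 : (0 < n2)%N) (d1_ge0 : 0 <= d1) (d1_neq_d2 : d1 <> d2)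
    (le_n1d1_n2d2 : n1%:R * d1 <= n2%:R * d2) :
  spectral_radius (quotient_graph n1 n2 d1 d2) =
    quotient_radius n1%:R n2%:R d1 d2.
Proof.
have MS := quotient_graph_two_degree n2_gt0 d1_ge0 d1_neq_d2 le_n1d1_n2d2.
have [_ eq_lam] :=
  spectral_radius_two_degree n2_gt0 d1_ge0 d1_neq_d2 le_n1d1_n2d2 MS.
apply/eq_lam; set M := quotient_graph n1 n2 d1 d2.
have low i : i \in degree_class M d1 -> exists k, i = lshift n2 k.
  rewrite inE degree_quotient_graph //; case: (split_ordP i) => k -> /=.
    by exists k.
  by move=> /eqP/esym.
have high i : i \in degree_class M d2 -> exists k, i = rshift n1 k.
  rewrite inE degree_quotient_graph //; case: (split_ordP i) => k -> /=.
    by move=> /eqP.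
  by exists k.
split=> [i j|].
  have [[k ik] [l jl]] := (low _ (enum_valP i), low _ (enum_valP j)).
  by rewrite mxE ik jl block_mxEul mxE.
apply/regular_inducedP => _ _ /high [k ->] /high [l ->].
apply: eq_bigr => j _; case: (split_ordP j) => j' ->.
  by rewrite !block_mxEdl !mxE.
by rewrite !block_mxEdr !mxE.
Qed.

Theorem theorem1p4 (R : realType) (n1 n2 : nat) (d1 d2 : R)
    (n2_gt0 : (0 < n2)%N) (d1_ge0 : 0 <= d1) (d2_ge0 : 0 <= d2)
    (d1_neq_d2 : d1 <> d2) (le_n1d1_n2d2 : n1%:R * d1 <= n2%:R * d2) :
  [/\ min_spectral_radius_attained (two_degree_graphs d1 n1 d2 n2),
      min_spectral_radius (two_degree_graphs d1 n1 d2 n2) =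
        2^-1 * (d2 - d1 * (n1%:R / n2%:R) +
                Num.sqrt (4 * d1 ^+ 2 * (n1%:R / n2%:R) +
                          (d2 - d1 * (n1%:R / n2%:R)) ^+ 2))
    & forall M : 'M[R]_(n1 + n2), two_degree_graphs d1 n1 d2 n2 M ->
        (spectral_radius M =
           min_spectral_radius (two_degree_graphs d1 n1 d2 n2) <->
         empty_graph (induced M (degree_class M d1)) /\
         regular_graph (induced M (degree_class M d2)))].
Proof.
rewrite -[X in _ = X]/(quotient_radius n1%:R n2%:R d1 d2).
set lam := quotient_radius _ _ _ _; set S := two_degree_graphs d1 n1 d2 n2.
have graph_le M := @spectral_radius_two_degree _ _ _ _ _ M
  n2_gt0 d1_ge0 d1_neq_d2 le_n1d1_n2d2.
have SM0 := quotient_graph_two_degree n2_gt0 d1_ge0 d1_neq_d2 le_n1d1_n2d2.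
set M0 := quotient_graph n1 n2 d1 d2 in SM0.
have rhoM0 : spectral_radius M0 = lam by exact: quotient_graph_extremal.
have min_lam : min_spectral_radius S = lam.
  have lam_lb : lbound [set spectral_radius M | M in S]%classic lam.
    by move=> _ [M SM <-]; exact: (graph_le M SM).1.
  apply/le_anti/andP; split.
    by rewrite -rhoM0; apply: ge_inf; [exists lam|exists M0].
  by apply: lb_le_inf => //; exists (spectral_radius M0), M0.
split; [|exact: min_lam|].
  exists M0; first exact: SM0.
  by move=> N SN; rewrite rhoM0; exact: (graph_le N SN).1.
by move=> M SM; rewrite min_lam; exact: (graph_le M SM).2.
Qed.
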